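(* Let $X$ be a finite set of points in $\mathbb{R}^d$ and let $r \ge 1$ be an integer. If $|X| \ge (d+1)(r-1)+2$, then the graph $\mathbf{RG}_{\mathrm{Tv}}(X,r)$ is connected.
   Context: An ordered Tverberg $r$-partition of a finite set $Y \subset \mathbb{R}^d$ is an ordered tuple $(Y_1,\ldots,Y_r)$ of pairwise disjoint subsets (possibly empty) with $Y_1 \cup \cdots \cup Y_r = Y$ and $\bigcap_{i=1}^r \mathrm{conv}(Y_i) \neq \emptyset$ (with $\mathrm{conv}(\emptyset)=\emptyset$). The graph $\mathbf{RG}_{\mathrm{Tv}}(X,r)$ has as vertices all ordered Tverberg $r$-partitions of $X$; two of them are adjacent if they differ only in the placement of a single point $x \in X$ among the $r$ classes, and deleting $x$ from either of the two partitions yields an ordered Tverberg $r$-partition of $X \setminus \{x\}$. *)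

(* Defs.v *)
From HB Require Import structures.
From mathcomp Require Import all_boot all_order all_algebra.
From mathcomp Require Import finmap.
From mathcomp Require Import reals.
From Stdlib Require Import Relation_Operators.
Set Implicit Arguments. Unset Strict Implicit. Unset Printing Implicit Defensive.
Import Order.TTheory GRing.Theory Num.Theory.
Local Open Scope ring_scope.
Local Open Scope fset_scope.

Section Tverberg.
Variables (R : realType) (d : nat).
Notation pt := 'rV[R]_d.

(* p lies in the convex hull of the finite set S (empty for S = fset0). *)
Definition in_conv (S : {fset pt}) (p : pt) : Prop :=
  exists w : pt -> R,
    [/\ (forall x, x \in S -> 0 <= w x),
        \sum_(x <- S) w x = 1 &
        \sum_(x <- S) w x *: x = p].

(* An ordered r-partition (Y_1,...,Y_r) of Y (classes possibly empty),
   given as the r-tuple of its classes. *)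
Definition is_ordered_partition (r : nat) (Y : {fset pt})
    (P : {ffun 'I_r -> {fset pt}}) : Prop :=
  (forall i j : 'I_r, i != j -> P i `&` P j = fset0) /\
  (forall x : pt, x \in Y <-> exists i : 'I_r, x \in P i).

Definition is_tverberg (r : nat) (Y : {fset pt})
    (P : {ffun 'I_r -> {fset pt}}) : Prop :=
  is_ordered_partition Y P /\ exists p : pt, forall i : 'I_r, in_conv (P i) p.

Definition del_pt (r : nat) (x : pt) (P : {ffun 'I_r -> {fset pt}})
  : {ffun 'I_r -> {fset pt}} := [ffun i => P i `\ x].

Definition rg_adj (r : nat) (X : {fset pt})
    (P Q : {ffun 'I_r -> {fset pt}}) : Prop :=
  is_tverberg X P /\ is_tverberg X Q /\ P != Q /\
  exists x : pt,
    [/\ x \in X,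
        (forall i : 'I_r, P i `\ x = Q i `\ x),
        is_tverberg (X `\ x) (del_pt x P) &
        is_tverberg (X `\ x) (del_pt x Q)].

(* The graph RG_Tv(X, r) is connected: any two vertices are joined by a
   path of edges (every edge joins two vertices). *)
Definition rg_connected (r : nat) (X : {fset pt}) : Prop :=
  forall P Q : {ffun 'I_r -> {fset pt}},
    is_tverberg X P -> is_tverberg X Q ->
    clos_refl_trans _ (rg_adj X) P Q.

End Tverberg.

(* Main.v *)
(* Sarkaria's transformation turns the ordered Tverberg partitions of X into
   the colourful choices T of one vector per point, in dimension
   n = (d+1)(r-1), whose convex hull contains 0; moving one point while keeping
   a Tverberg partition of the others is changing one entry of T while the
   remaining vectors still have 0 in their hull. Give a change of one entry the
   height "squared distance from 0 to the hull of the unchanged vectors". With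
   no bound on the height everything is connected, and there are finitely many
   heights, so it suffices to push a path below its maximal height c > 0. If z
   is the nearest point for a choice T at level c, the vectors needed to
   represent z lie on the hyperplane <y,z> = |z|^2 of dimension n - 1; as there
   are at least n + 2 vectors, the polytope of representations of z has
   dimension at least 2 and hence a connected boundary, so that one can walk
   between any two superfluous entries of T through pairs of simultaneously
   superfluous ones. Exchanging superfluous entries for vectors y with
   <y,z> <= 0 reroutes the path strictly below c. *)
Require Import Defs.
From HB Require Import structures.
From mathcomp Require Import all_boot all_order all_algebra.
From mathcomp Require Import finmap.
From mathcomp Require Import boolp classical_sets reals topology normedtype derive.
From mathcomp Require Import ring lra.
From Stdlib Require Import Relation_Operators.
Set Implicit Arguments. Unset Strict Implicit. Unset Printing Implicit Defensive.
Import Order.TTheory GRing.Theory Num.Theory.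
Import numFieldNormedType.Exports.
Local Open Scope ring_scope.

(** * Paths as reflexive-transitive closures *)

Section ReflexiveTransitiveClosure.
Variable (A : Type).
Implicit Types e : A -> A -> Prop.

Lemma crt_mono e e' x y : (forall a b, e a b -> e' a b) ->
  clos_refl_trans _ e x y -> clos_refl_trans _ e' x y.
Proof.
move=> ee'; elim=> [a b /ee'|a|a b c _ ab _ bc];
  [exact: rt_step | exact: rt_refl | exact: rt_trans bc].
Qed.

Lemma crt_sym e x y : (forall a b, e a b -> e b a) ->
  clos_refl_trans _ e x y -> clos_refl_trans _ e y x.
Proof.
move=> es; elim=> [a b /es|a|a b c _ ab _ bc];
  [exact: rt_step | exact: rt_refl | exact: rt_trans ab].
Qed.

End ReflexiveTransitiveClosure.

(** * Ratio test and lower envelopes *)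

Section OrderedField.
Variables (R : realFieldType) (I : finType).
Implicit Types l w : I -> R.

(** As in the simplex method, [s] is the least ratio [l k / - w k] over [w k < 0]: the moment when a
    first weight vanishes on the way along [w]. *)
Lemma ratio_test l w : (forall i, 0 <= l i) -> (exists k, w k < 0) ->
  exists k s, [/\ 0 <= s, w k < 0, l k + s * w k = 0
                & forall j, 0 <= l j + s * w j].
Proof.
move=> l0 [k0 wk0].
case: (@arg_minP _ R I k0 (fun k => w k < 0) (fun k => l k / - w k) wk0) => k wk kmin.
have s0 : 0 <= l k / - w k by rewrite divr_ge0// oppr_ge0 ltW.
exists k, (l k / - w k); split=> // [|j].
  by rewrite invrN mulrN mulNr divfK ?subrr// lt_eqF.
have [wj|wj] := ltP (w j) 0; last by rewrite addr_ge0// mulr_ge0.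
have := kmin j wj; rewrite ler_pdivlMr ?oppr_gt0// mulrN => h; lra.
Qed.

Lemma exists_neg w : \sum_i w i = 0 -> (exists i, w i != 0) ->
  exists i, w i < 0.
Proof.
move=> w0 [i wi]; apply: contrapT => h.
have wge j : 0 <= w j by rewrite leNgt; apply/negP => wj; apply: h; exists j.
move/eqP: w0; rewrite psumr_eq0// => /allP/(_ i (mem_index_enum i)) /=.
by rewrite (negPf wi).
Qed.

(* On [s,t] the indices attaining the lower envelope of finitely many affine
   functions change only at points where two of them attain it together. *)
Lemma envelope_chain (K : pred I) (a b : I -> R) (s t : R) (k k' : I) :
  let active u j := K j /\ forall j', K j' -> a j + u * b j <= a j' + u * b j' in
  s <= t -> active s k -> active t k' ->
  clos_refl_trans _ (fun i j => exists u, [/\ s <= u <= t, active u i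
                                            & active u j]) k k'.
Proof.
move=> active.
(* Induction on the number of functions strictly below that of [j] at [t]. *)
pose lower j := #|[pred j' | K j' && (a j' + t * b j' < a j + t * b j)]|.
have [n] := ubnP (lower k); elim: n => // n IHn in s k *.
rewrite ltnS => kn st ks k't.
have [kt|] := leP (a k + t * b k) (a k' + t * b k').
  apply: rt_step; exists t; rewrite st lexx; split=> //.
  split; first by case: ks.
  by move=> j' Kj'; apply: (le_trans kt); apply k't.2.
move=> k'k.
pose P j := K j && (a j + t * b j < a k + t * b k).
(* [cross j] is where function [j] meets function [k]; at the earliest crossing over [P], both
   functions attain the envelope. *)
pose cross j := (a j - a k) / (b k - b j).
have Pb j : P j -> s * (b k - b j) <= a j - a k < t * (b k - b j).
  move=> /andP[Kj jk]; have := ks.2 j Kj; rewrite !mulrBr => ?.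
  by apply/andP; split; lra.
have bpos j : P j -> 0 < b k - b j.
  move=> /Pb /andP[h1 h2]; rewrite ltNge; apply/negP => b0.
  have := le_lt_trans h1 h2; rewrite ltNge => /negP; apply.
  by rewrite ler_wnM2r.
have Pk' : P k' by rewrite /P k'k andbT; case: k't.
case: (@arg_minP _ R I k' P cross Pk') => l Pl lmin.
have /andP[sl lt] : s <= cross l < t.
  by rewrite ler_pdivlMr ?ltr_pdivrMr ?bpos// Pb.
have crossE : a k + cross l * b k = a l + cross l * b l.
  have : cross l * (b k - b l) = a l - a k by rewrite divfK// gt_eqF// bpos.
  by rewrite mulrBr; lra.
have kl : active (cross l) k.
  split; first by case: ks.
  move=> j Kj; have [Pj|] := boolP (P j).
    have := lmin j Pj; rewrite [in X in _ <= X]/cross ler_pdivlMr ?bpos//.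
    by rewrite mulrBr; lra.
  rewrite /P Kj /= -leNgt => tj; have sj := ks.2 j Kj.
  have [bb|bb] := leP (b j) (b k).
    by have : cross l * (b k - b j) <= t * (b k - b j);
      [rewrite ler_wpM2r ?subr_ge0// ltW|rewrite !mulrBr; lra].
  by have : cross l * (b k - b j) <= s * (b k - b j);
      [rewrite ler_wnM2r ?subr_le0// ltW|rewrite !mulrBr; lra].
have ll : active (cross l) l.
  split; first by case/andP: Pl.
  by move=> j Kj; rewrite -crossE; apply kl.2.
apply: (rt_trans _ _ _ l).
  by apply: rt_step; exists (cross l); rewrite sl ltW.
have: clos_refl_trans I (fun i j => exists u, [/\ cross l <= u <= t,
    active u i & active u j]) l k'.
  apply: IHn => //; last exact: ltW.
  rewrite (leq_trans _ kn)//; apply: proper_card; apply/properP; split.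
    apply/fintype.subsetP => j; rewrite !inE => /andP[-> /= jl].
    by apply: (lt_trans jl); case/andP: Pl.
  by exists l; rewrite !inE ?ltxx ?andbF.
by apply: crt_mono => i j [u [/andP[lu ut] ui uj]]; exists u; rewrite (le_trans sl lu).
Qed.

End OrderedField.

(** * The standard inner product *)

Section InnerProduct.
Variables (R : realFieldType) (n : nat).
Implicit Types u v w : 'rV[R]_n.

Definition dot u v : R := \sum_k u 0 k * v 0 k.

Lemma dotC u v : dot u v = dot v u.
Proof. by apply: eq_bigr => k _; rewrite mulrC. Qed.

Lemma dotDl u v w : dot (u + v) w = dot u w + dot v w.
Proof. by rewrite -big_split; apply: eq_bigr => k _; rewrite !mxE mulrDl. Qed.

Lemma dotZl a u v : dot (a *: u) v = a * dot u v.
Proof. by rewrite mulr_sumr; apply: eq_bigr => k _; rewrite !mxE mulrA. Qed.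

Lemma dotNl u v : dot (- u) v = - dot u v.
Proof. by rewrite -scaleN1r dotZl mulN1r. Qed.

Lemma dot0l v : dot 0 v = 0.
Proof. by rewrite -(scale0r 0) dotZl mul0r. Qed.

Lemma dot_suml (I : finType) (u : I -> 'rV[R]_n) v :
  dot (\sum_i u i) v = \sum_i dot (u i) v.
Proof.
apply: (big_morph (dot^~ v)) => [u1 u2|]; [exact: dotDl | exact: dot0l].
Qed.

Lemma dot_ge0 u : 0 <= dot u u.
Proof. by apply: sumr_ge0 => k _; rewrite -expr2 sqr_ge0. Qed.

Lemma dot_eq0 u : dot u u <= 0 -> u = 0.
Proof.
move=> u0; have /eqP : dot u u = 0 by apply/eqP; rewrite eq_le u0 dot_ge0.
rewrite psumr_eq0 => [/allP h|k _]; last by rewrite -expr2 sqr_ge0.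
apply/rowP => k; rewrite mxE; apply/eqP.
by have := h k (mem_index_enum k); rewrite /= mulf_eq0 orbb.
Qed.

Lemma dotBB u v : dot (u - v) (u - v) = dot u u - 2 * dot u v + dot v v.
Proof.
rewrite dotDl dotNl (dotC u) (dotC v (u - v)) !dotDl !dotNl (dotC v u); ring.
Qed.

End InnerProduct.

(** * Colourful choices and exchanges *)

Section Colourful.
Variables (R : realType) (n : nat) (I J : finType) (V : I -> J -> 'rV[R]_n).
Implicit Types (T : {ffun I -> J}) (l w : I -> R) (z : 'rV[R]_n) (c : R).

Definition weights l := (forall i, 0 <= l i) /\ \sum_i l i = 1.

Definition bary T l := \sum_i l i *: V i (T i).

Definition sqn T l := dot (bary T l) (bary T l).

Definition upd T i a : {ffun I -> J} := [ffun k => if k == i then a else T k].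

Lemma updC T i k a b : i != k -> upd (upd T i a) k b = upd (upd T k b) i a.
Proof.
move=> ik; apply/ffunP => m; rewrite !ffunE.
by case: (m =P k) => // ->; case: (k =P i) => // ki; rewrite ki eqxx in ik.
Qed.

Lemma bary_eq T T' l : (forall i, l i != 0 -> T i = T' i) ->
  bary T l = bary T' l.
Proof.
move=> h; apply: eq_bigr => i _; have [->|/h ->//] := eqVneq (l i) 0.
by rewrite !scale0r.
Qed.

Lemma bary_upd T l i a : l i = 0 -> bary (upd T i a) l = bary T l.
Proof.
move=> li; apply: bary_eq => k; rewrite ffunE.
by case: (k =P i) => // ->; rewrite li eqxx.
Qed.

Lemma bary_add T l w s : bary T (fun i => l i + s * w i) = bary T l + s *: bary T w.
Proof.
rewrite scaler_sumr -big_split; apply: eq_bigr => i _.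
by rewrite scalerDl scalerA.
Qed.

(* The exchange step of Barany's proof of colourful Caratheodory. *)
Lemma exchange_lt T l i : weights l ->
  dot (V i (T i)) (bary T l) < sqn T l ->
  exists l', [/\ weights l', forall k, k != i -> l k = 0 -> l' k = 0
               & sqn T l' < sqn T l].
Proof.
move=> [l0 l1]; rewrite /sqn; set y := V i (T i); set z := bary T l => lt.
set D := dot (y - z) (y - z); set a := dot z z - dot y z.
have D0 : 0 <= D by exact: dot_ge0.
have a0 : 0 < a by rewrite subr_gt0.
have aD : 0 < a + D by lra.
(* Moving by [e] from [z] towards [y] changes the squared norm by [e * (e * D - 2 * a)]; this [e]
   makes that negative and stays at most 1 for every [D]. *)
have [e [e0 e1 eD]] : exists e, [/\ 0 < e, e <= 1 & e * (a + D) = a].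
  exists (a / (a + D)); rewrite divr_gt0// ler_pdivrMr// mul1r lerDl D0.
  by rewrite divfK// gt_eqF.
pose l' k := (1 - e) * l k + e * (k == i)%:R.
have baryE : bary T l' = z + e *: (y - z).
  rewrite /bary; under eq_bigr do rewrite scalerDl -!scalerA.
  rewrite big_split -!scaler_sumr -/(bary T l) -/z /=.
  rewrite (bigD1 i)//= eqxx scale1r big1 ?addr0; last first.
    by move=> k /negPf ->; rewrite scale0r.
  by rewrite scalerBl scale1r scalerBr -/y addrAC addrA.
exists l'; split.
- split=> [k|].
    by rewrite addr_ge0// mulr_ge0 ?subr_ge0 ?ler0n// ltW.
  rewrite big_split /= -!mulr_sumr l1 (bigD1 i)//= eqxx big1 ?addr0 ?mulr1 ?subrK//.
  by move=> k /negPf ->.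
- by move=> k /negPf ki lk; rewrite /l' lk ki !mulr0 addr0.
rewrite baryE -(opprK (e *: (y - z))) dotBB dotNl (dotC (e *: _) (- _)) dotNl.
rewrite opprK dotZl (dotC (y - z)) dotZl -/D (dotC z) dotNl dotZl dotDl dotNl.
rewrite -subr_lt0.
have -> : dot z z - 2 * - (e * (dot y z - dot z z)) + e * (e * D) - dot z z =
  e * (e * (a + D) - e * a - 2 * a) by rewrite /a; ring.
rewrite eD pmulr_rlt0//; have : 0 <= e * a by rewrite mulr_ge0// ltW.
lra.
Qed.

(** Any weights avoiding [i] may certify the height; for downward closed [C] this amounts to [C] at
    the minimum. *)
Definition edge (C : R -> Prop) T T' := exists i l,
  [/\ weights l, l i = 0, forall k, k != i -> T k = T' k & C (sqn T l)].

Lemma edge_sym C T T' : edge C T T' -> edge C T' T.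
Proof.
move=> [i [l [lw li TT' Cl]]]; exists i, l; split=> // [k /TT' ->//|].
rewrite /sqn (_ : bary T' l = bary T l)//; apply: bary_eq => k lk.
by rewrite TT'//; apply: contraNN lk => /eqP ->; rewrite li.
Qed.

(** * Linear dependencies and the polytope of representations *)

Section Kernel.
Hypothesis cardI : (n.+2 <= #|I|)%N.

(** The matrix has [n + 1] columns, the coordinates and an indicator forcing [w i = 0]; with at
    least [n + 2] rows its left kernel is nonzero. *)
Lemma dependency T i : exists w,
  [/\ w i = 0, exists k, w k != 0 & bary T w = 0].
Proof.
pose B : 'M[R]_(#|I|, n + 1) := row_mx (\matrix_(k, j) V (enum_val k) (T (enum_val k)) 0 j)
  (\col_k ((enum_val k == i)%:R)).
have : kermx B != 0.
  rewrite -mxrank_eq0 mxrank_ker subn_eq0 -ltnNge.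
  by rewrite (leq_ltn_trans (rank_leq_col _))// addn1.
case/rowV0Pn => v; rewrite sub_kermx mul_mx_row => /eqP vB v0.
have [v1 v2] := eq_row_mx (etrans vB (esym (row_mx0 _ _ _ _))).
have sumE (F : I -> R) : \sum_(k < #|I|) v 0 k * F (enum_val k) =
    \sum_i v 0 (enum_rank i) * F i.
  rewrite [RHS](reindex (@enum_val I I)) /=; last exact/onW_bij/enum_val_bij.
  by apply: eq_bigr => k _; rewrite enum_valK.
exists (fun k => v 0 (enum_rank k)); split.
- have /rowP/(_ 0) := v2; rewrite !mxE.
  under eq_bigr do rewrite mxE.
  rewrite (sumE (fun k => (k == i)%:R)) (bigD1 i)//= eqxx mulr1 big1 ?addr0//.
  by move=> k /negPf ->; rewrite mulr0.
- have [k vk] : exists k, v 0 k != 0.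
    apply: contrapT => h; move/eqP: v0; apply; apply/rowP => k; rewrite mxE.
    by apply/eqP; apply: contrapT => /negP vk; apply: h; exists k.
  by exists (enum_val k); rewrite enum_valK.
- apply/rowP => j; have /rowP/(_ j) := v1 => v1j.
  rewrite mxE [RHS]mxE in v1j; rewrite [RHS]mxE -v1j.
  rewrite summxE; under [RHS]eq_bigr do rewrite mxE.
  by rewrite (sumE (fun k => V k (T k) 0 j)); apply: eq_bigr => k _; rewrite mxE.
Qed.

(** The [l]-average of the inner products with [bary T l] is [sqn T l], so none of positive weight
    can exceed it. *)
Lemma support_plane T l i : weights l ->
  (forall k, l k != 0 -> sqn T l <= dot (V k (T k)) (bary T l)) ->
  l i != 0 -> dot (V i (T i)) (bary T l) = sqn T l.
Proof.
move=> [l0 l1] min li.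
pose g k := l k * (dot (V k (T k)) (bary T l) - sqn T l).
have g0 k : 0 <= g k.
  have [lk|lk] := eqVneq (l k) 0; first by rewrite /g lk mul0r.
  by rewrite mulr_ge0// subr_ge0 min.
have /eqP : \sum_k g k = 0.
  under eq_bigr do rewrite /g mulrBr -dotZl.
  by rewrite big_split /= -dot_suml sumrN -mulr_suml l1 mul1r subrr.
rewrite psumr_eq0// => /allP/(_ i (mem_index_enum i))/=.
by rewrite mulf_eq0 (negPf li)/= subr_eq0 => /eqP.
Qed.

(* When all points lie on a hyperplane missing the origin, a linear dependency
   is automatically an affine one. *)
Lemma dependency_sum0 T w z i : 0 < dot z z -> w i = 0 -> bary T w = 0 ->
  (forall k, k != i -> dot (V k (T k)) z = dot z z) -> \sum_k w k = 0.
Proof.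
move=> z0 wi w0 plane; apply: (mulIf (lt0r_neq0 z0)).
rewrite mul0r mulr_suml -[RHS](dot0l z) -w0 dot_suml; apply: eq_bigr => k _.
rewrite dotZl; have [->|/plane ->//] := eqVneq k i; by rewrite wi !mul0r.
Qed.

(** If only [i] has weight zero, the other vectors lie on the supporting hyperplane; a dependency
    avoiding [i] then sums to zero, and the ratio test along it kills another weight with the
    barycentre fixed. *)
Lemma caratheodory T l i : weights l -> l i = 0 -> 0 < sqn T l ->
  (forall k, k != i -> sqn T l <= dot (V k (T k)) (bary T l)) ->
  exists k l', [/\ k != i, weights l', l' i = 0, l' k = 0 & bary T l' = bary T l].
Proof.
move=> lw li c0 min.
have [[k [ki lk]]|h] := pselect (exists k, k != i /\ l k = 0).
  by exists k, l.
have lpos k : k != i -> l k != 0.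
  by move=> ki; apply/eqP => lk; apply: h; exists k.
have lneq k : l k != 0 -> k != i by apply: contraNN => /eqP ->; rewrite li.
have [w [wi wn0 w0]] := dependency T i.
have ws : \sum_k w k = 0.
  apply: (@dependency_sum0 T w (bary T l) i) => // k ki.
  by apply: support_plane; rewrite ?lpos// => m /lneq/min.
have [k [s [s0 wk lk lge]]] := ratio_test lw.1 (exists_neg ws wn0).
exists k, (fun j => l j + s * w j); split=> //.
- by apply/eqP => ki; move: wk; rewrite ki wi ltxx.
- by split=> //; rewrite big_split /= -mulr_sumr ws mulr0 addr0 lw.2.
- by rewrite li wi mulr0 addr0.
- by rewrite bary_add w0 scaler0 addr0.
Qed.

Definition removable2 T z i k := exists l,
  [/\ weights l, l i = 0, l k = 0 & bary T l = z].

(* The polytope of weights representing [z] has dimension at least 2, hence a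
   connected boundary; concretely, slide the segment from [u] to [v] along a
   direction [w] of the polytope until it hits the boundary. *)
Lemma removable_chain T z u v i k : 0 < dot z z ->
  (forall k, dot z z <= dot (V k (T k)) z) ->
  weights u -> u i = 0 -> bary T u = z ->
  weights v -> v k = 0 -> bary T v = z ->
  clos_refl_trans _ (removable2 T z) i k.
Proof.
move=> z0 min uw ui uz vw vk vz.
have [[m [um vm]]|h] := pselect (exists m, u m = 0 /\ v m = 0).
  by apply: (rt_trans _ _ _ m); apply: rt_step; [exists u | exists v].
(* Every index now has positive weight in [u] or in [v]. *)
have plane m : dot (V m (T m)) z = dot z z.
  have [um|um] := eqVneq (u m) 0.
    have vm : v m != 0 by apply/eqP => vm; apply: h; exists m.
    by move: (@support_plane T v m vw); rewrite /sqn vz; apply.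
  by move: (@support_plane T u m uw); rewrite /sqn uz; apply.
(* The sign of [w] matters at the end of the chain: if [w k < 0], then [k] is active at [t = 1]. *)
have [w [wi wn0 w0 wk]] : exists w,
    [/\ w i = 0, exists k, w k != 0, bary T w = 0 & w k <= 0].
  have [w [wi [m wm] w0]] := dependency T i.
  have [wk|wk] := leP (w k) 0; first by exists w; split=> //; exists m.
  exists (fun m => 0 + (-1) * w m); split.
  - by rewrite wi mulr0 addr0.
  - by exists m; rewrite add0r mulN1r oppr_eq0.
  - by rewrite bary_add w0 scaler0 addr0 [LHS]big1// => j _; rewrite scale0r.
  - by rewrite add0r mulN1r oppr_le0 ltW.
have ws : \sum_m w m = 0 by apply: (@dependency_sum0 T w z i).
pose K m := w m < 0.
(* From the point at [t] on the segment, weight [m] vanishes after distance [a m + t * b m] along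
   [w]. The envelope is the exit distance, and [p t m] the exit point when [m] is active. *)
pose a m := u m / - w m; pose b m := (v m - u m) / - w m.
pose act t m := K m /\ forall m', K m' -> a m + t * b m <= a m' + t * b m'.
pose p t m j := u j + t * (v j - u j) + (a m + t * b m) * w j.
have fE t m : K m -> u m + t * (v m - u m) = (a m + t * b m) * - w m.
  by move=> Km; rewrite /a /b mulrA -mulrDl divfK// oppr_eq0 lt_eqF.
have pzero t m m' : act t m -> act t m' -> p t m m' = 0.
  move=> [Km mmin] [Km' mmin'].
  rewrite /p; have -> : a m + t * b m = a m' + t * b m' by apply/eqP; rewrite eq_le mmin// mmin'.
  by rewrite fE// mulrN addNr.
have pseg t j : 0 <= t <= 1 -> 0 <= u j + t * (v j - u j).
  move=> /andP[t0 t1].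
  have -> : u j + t * (v j - u j) = (1 - t) * u j + t * v j by ring.
  by rewrite addr_ge0// mulr_ge0 ?subr_ge0// ?uw.1 ?vw.1.
have fge t m : 0 <= t <= 1 -> K m -> 0 <= a m + t * b m.
  by move=> t01 Km; rewrite -(@pmulr_lge0 _ (- w m)) ?oppr_gt0// -fE// pseg.
have pw t m : 0 <= t <= 1 -> act t m -> weights (p t m) /\ bary T (p t m) = z.
  move=> t01 am; split; [split=> [j|]|].
  - have [wj|wj] := leP 0 (w j).
      by rewrite addr_ge0 ?pseg// mulr_ge0// fge//; case: am.
    rewrite /p fE// mulrN addrC subr_ge0 ler_wnM2r ?(ltW wj)//.
    by apply am.2.
  - rewrite !big_split /= -!mulr_sumr ws mulr0 addr0 big_split /= sumrN.
    by rewrite uw.2 vw.2 subrr mulr0 addr0.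
  - rewrite /p bary_add w0 scaler0 addr0 bary_add uz.
    have -> : bary T (fun j => v j - u j) = 0.
      rewrite /bary; under eq_bigr do rewrite scalerBl.
      by rewrite big_split /= sumrN -/(bary T v) -/(bary T u) uz vz subrr.
    by rewrite scaler0 addr0.
have [m0 Km0] := exists_neg ws wn0.
have argact t : exists m, act t m.
  case: (@arg_minP _ R I m0 K (fun m => a m + t * b m) Km0) => m Km mmin.
  by exists m.
have [k0 k0a] := argact 0.
(* At [v] the weight of [k] is zero: either [w k = 0] and the exit point keeps it so, or the exit
   distance is 0 and [k] is active. *)
have [k1 [k1a k1k]] : exists k1, act 1 k1 /\ clos_refl_trans _ (removable2 T z) k1 k.
  have [wk0|wk0] := eqVneq (w k) 0.
    have [k1 k1a] := argact 1; exists k1; split=> //; apply: rt_step.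
    exists (p 1 k1); have [] := pw 1 k1 _ k1a; first by rewrite ler01 lexx.
    split=> //; first exact: pzero.
    by rewrite /p wk0 vk mulr0 addr0; ring.
  exists k; split; last exact: rt_refl.
  have Kk : K k by rewrite /K lt_neqAle wk0.
  split=> // m' Km'.
  have -> : a k + 1 * b k = 0 by rewrite /a /b vk; ring.
  by apply: fge => //; rewrite ler01 lexx.
apply: (rt_trans _ _ _ k0).
  apply: rt_step; exists (p 0 k0); have [] := pw 0 k0 _ k0a.
    by rewrite ler01 lexx.
  split=> //; last exact: pzero.
  by rewrite /p wi ui mulr0 addr0; ring.
apply: rt_trans k1k.
apply: (crt_mono _ (envelope_chain ler01 k0a k1a)) => m m' [t [t01 ma ma']].
by exists (p t m); have [] := pw t m t01 ma; split=> //; exact: pzero.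
Qed.

End Kernel.

Lemma card_gt1_neq (i : I) : (1 < #|I|)%N -> exists k, k != i.
Proof.
rewrite (cardD1 i) inE ltnS => /card_gt0P[k].
by rewrite !inE andbT; exists k.
Qed.

(** * Rerouting paths below their maximal height *)

Section Descent.
Hypothesis cardI : (n.+2 <= #|I|)%N.
Hypothesis balanced : forall i z, exists a, dot (V i a) z <= 0.

Let path C := clos_refl_trans _ (edge C).

(** The path passes through the choice with both entries exchanged: after one exchange,
    [exchange_lt] gives weights below the level that still avoid the other index. *)
Lemma swap2 T l i k a b : weights l -> l i = 0 -> l k = 0 -> i != k ->
  dot (V i a) (bary T l) < sqn T l -> dot (V k b) (bary T l) < sqn T l ->
  path (fun x => x < sqn T l) (upd T i a) (upd T k b).
Proof.
have half T' l' i' k' a' b' : weights l' -> l' i' = 0 -> l' k' = 0 -> i' != k' ->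
    dot (V i' a') (bary T' l') < sqn T' l' ->
    edge (fun x => x < sqn T' l') (upd T' i' a') (upd (upd T' i' a') k' b').
  move=> lw li lk ik lta.
  have [] := @exchange_lt (upd T' i' a') l' i' lw.
    by rewrite /sqn bary_upd// ffunE eqxx.
  move=> m [mw m0]; rewrite {2}/sqn bary_upd// -/(sqn _ _) => mlt.
  exists k', m; split=> //; first by rewrite m0// eq_sym.
  by move=> j /negPf jk; rewrite [RHS]ffunE jk.
move=> lw li lk ik lta ltb.
apply: (rt_trans _ _ _ (upd (upd T i a) k b)); apply: rt_step; first exact: half.
by rewrite updC//; apply: edge_sym; apply: half => //; rewrite eq_sym.
Qed.

Lemma path_sym C T T' : path C T T' -> path C T' T.
Proof. by apply: crt_sym => *; exact: edge_sym. Qed.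

Lemma swap1 T l i a a' : weights l -> l i = 0 -> 0 < sqn T l ->
  (forall k, k != i -> sqn T l <= dot (V k (T k)) (bary T l)) ->
  dot (V i a) (bary T l) < sqn T l -> dot (V i a') (bary T l) < sqn T l ->
  path (fun x => x < sqn T l) (upd T i a) (upd T i a').
Proof.
move=> lw li c0 min lta lta'.
have [k [m [ki mw mi mk mE]]] := caratheodory cardI lw li c0 min.
have [b /le_lt_trans/(_ c0) ltb] := balanced k (bary T l).
move: lta lta' ltb; rewrite /sqn -mE -/(sqn T m) => lta lta' ltb.
rewrite eq_sym in ki.
apply: (rt_trans _ _ _ (upd T k b)); first exact: swap2.
by apply: path_sym; exact: swap2.
Qed.

Definition high c T := forall l, weights l -> c <= sqn T l.

(* [A] stands for [T] on paths staying strictly below the level [c]: it is [T]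
   itself, or [T] lowered by exchanging a point that is superfluous for
   representing the point of the hull nearest to the origin. *)
Definition lowering c T A := (~ high c T /\ A = T) \/
  (high c T /\ exists i l a, [/\ weights l, l i = 0, sqn T l = c,
     dot (V i a) (bary T l) < c & A = upd T i a]).

Lemma high_dot c T l k : high c T -> weights l -> sqn T l = c ->
  c <= dot (V k (T k)) (bary T l).
Proof.
move=> hi lw lc; rewrite leNgt; apply/negP; rewrite -lc => lt.
have [m [mw _]] := exchange_lt lw lt; rewrite lc => mc.
by have := hi m mw; rewrite leNgt mc.
Qed.

Lemma dot_bary_ge c T l z : weights l ->
  (forall k, c <= dot (V k (T k)) z) -> c <= dot (bary T l) z.
Proof.
move=> [l0 l1] h; rewrite dot_suml -[c]mul1r -l1 mulr_suml.
by apply: ler_sum => k _; rewrite dotZl ler_wpM2l.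
Qed.

Lemma high_unique c T l m : high c T -> weights l -> sqn T l = c ->
  weights m -> sqn T m = c -> bary T m = bary T l.
Proof.
move=> hi lw lc mw mc; apply/eqP; rewrite -subr_eq0; apply/eqP/dot_eq0.
rewrite dotBB -/(sqn T m) -/(sqn T l) lc mc.
have := @dot_bary_ge c T m (bary T l) mw (fun k => high_dot k hi lw lc).
lra.
Qed.

Lemma lowering_path c T A B : 0 < c -> lowering c T A -> lowering c T B ->
  path (fun x => x < c) A B.
Proof.
move=> c0 [[lo ->]|[hi [i [l [a [lw li lc la ->]]]]]] [[lo' ->]|].
- exact: rt_refl.
- by case=> hi.
- by have := lo' hi.
case=> _ [k [m [b [mw mk mc mb ->]]]].
have mz := high_unique hi lw lc mw mc.
set z := bary T l in la mz.
have zz : dot z z = c by [].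
have zmin j : dot z z <= dot (V j (T j)) z by rewrite zz; exact: high_dot.
have z0 : 0 < dot z z by rewrite zz.
have sw j m' a' b' : weights m' -> m' j = 0 -> bary T m' = z ->
    dot (V j a') z < c -> dot (V j b') z < c ->
    path (fun x => x < c) (upd T j a') (upd T j b').
  move=> mw' mj' mz' lta ltb.
  have mc' : sqn T m' = c by rewrite /sqn mz'.
  rewrite -mc'; apply: swap1; rewrite ?mc' ?mz'//.
  by move=> j' _; rewrite -zz.
(* The case [j = j'] stands apart because an empty chain provides no weights avoiding [j]. *)
have chain j j' : clos_refl_trans _ (removable2 T z) j j' -> j = j' \/
    forall a' b', dot (V j a') z < c -> dot (V j' b') z < c ->
      path (fun x => x < c) (upd T j a') (upd T j' b').
  elim=> {j j'} [j j' [m' [mw' mj mj' mz']]|j|j1 j2 j3 _ [->|h12] _ [<-|h23]].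
  - right=> a' b' lta ltb; have [jj'|jj'] := eqVneq j j'.
      by subst j'; apply: (sw j m').
    have mc' : sqn T m' = c by rewrite /sqn mz'.
    by rewrite -mc'; apply: swap2; rewrite ?mc' ?mz'.
  - by left.
  - by left.
  - by right.
  - by right.
  right=> a' b' lta ltb; have [y /le_lt_trans/(_ c0) lty] := balanced j2 z.
  by apply: (rt_trans _ _ _ (upd T j2 y)); [exact: h12 | exact: h23].
have [ik|] := chain i k (removable_chain cardI z0 zmin lw li erefl mw mk mz).
  by subst k; apply: (sw i l); rewrite // -mz.
by apply; rewrite // -mz.
Qed.

(** If the unchanged vectors reach below [c], both ends are their own lowerings. Otherwise
    [bary T l] is the nearest point of their hull, and [swap1] joins the two ends with entry [i]
    exchanged where needed. *)
Lemma edge_lowering c T T' : 0 < c -> edge (fun x => x <= c) T T' ->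
  exists A B, [/\ lowering c T A, lowering c T' B & path (fun x => x < c) A B].
Proof.
move=> c0 [i [l [lw li TT' lc]]].
have [[m [mw mi mlt]]|hmin] :=
    pselect (exists m, [/\ weights m, m i = 0 & sqn T m < c]).
  have TT'm : bary T' m = bary T m.
    by apply: bary_eq => k mk; rewrite TT'//; apply: contraNN mk => /eqP ->; rewrite mi.
  exists T, T'; split.
  - by left; split=> // hi; have := hi m mw; rewrite leNgt mlt.
  - by left; split=> // hi; have := hi m mw; rewrite leNgt /sqn TT'm mlt.
  - by apply: rt_step; exists i, m.
have {}lc : sqn T l = c.
  by apply/eqP; rewrite eq_le lc leNgt; apply/negP => lt; apply: hmin; exists l.
have min k : k != i -> c <= dot (V k (T k)) (bary T l).
  move=> ki; rewrite leNgt; apply/negP; rewrite -lc => lt.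
  have [m [mw m0 mlt]] := exchange_lt lw lt; apply: hmin; exists m.
  by rewrite -lc m0// eq_sym.
(* An end whose entry [i] lies below the hyperplane is not high and stays; otherwise it is high with
   [bary T l] still nearest, and [balanced] gives the new entry. *)
have low (S : {ffun I -> J}) : (forall k, k != i -> S k = T k) ->
    exists a, dot (V i a) (bary T l) < c /\ lowering c S (upd T i a).
  move=> ST.
  have Sz : bary S l = bary T l.
    by apply: bary_eq => k lk; rewrite ST//; apply: contraNN lk => /eqP ->; rewrite li.
  have Sc : sqn S l = c by rewrite /sqn Sz.
  have updS a : upd S i a = upd T i a.
    by apply/ffunP => k; rewrite !ffunE; case: (eqVneq k i) => // /ST.
  have [lt|ge] := ltP (dot (V i (S i)) (bary T l)) c.
    exists (S i); split=> //; left; split.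
      move=> hi; rewrite -Sz -Sc in lt; have [m [mw _]] := exchange_lt lw lt.
      by rewrite Sc ltNge hi.
    by rewrite -updS; apply/ffunP => k; rewrite ffunE; case: eqP => // ->.
  have [a /le_lt_trans/(_ c0) lta] := balanced i (bary T l).
  exists a; split=> //; right; split; last first.
    by exists i, l, a; rewrite Sz updS.
  move=> m mw.
  have : c <= dot (bary S m) (bary T l).
    apply: dot_bary_ge => // k.
    by have [->//|ki] := eqVneq k i; rewrite ST// min.
  have := dot_ge0 (bary S m - bary T l).
  rewrite dotBB -/(sqn T l) lc -/(sqn S m); lra.
have [a [lta Ta]] := low T (fun _ _ => erefl).
have [b [ltb T'b]] := low T' (fun k ki => esym (TT' k ki)).
exists (upd T i a), (upd T i b); split=> //.
by rewrite -lc; apply: swap1; rewrite ?lc.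
Qed.

Lemma path_descent c T T' : 0 < c -> ~ high c T -> ~ high c T' ->
  path (fun x => x <= c) T T' -> path (fun x => x < c) T T'.
Proof.
move=> c0 loT loT' TT'.
(* Interior vertices of the path may be high, hence the arbitrary lowerings; the ends are not high
   and are their own lowerings. *)
suff h A : lowering c T A ->
    exists B, lowering c T' B /\ path (fun x => x < c) A B.
  have [|B [T'B TB]] := h T; first by left.
  by apply: rt_trans TB (lowering_path c0 T'B _); left.
move: A; elim: TT' => {T T' loT loT'} [T T' TT' A TA|T A TA|T1 T2 T3 _ h12 _ h23 A T1A].
- have [A' [B [TA' T'B A'B]]] := edge_lowering c0 TT'; exists B; split=> //.
  exact: rt_trans (lowering_path c0 TA TA') A'B.
- by exists A; split=> //; exact: rt_refl.
have [B [/h23[C [T3C BC]] AB]] := h12 A T1A.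
by exists C; split=> //; exact: rt_trans BC.
Qed.

Lemma swap_connected T T' : path (fun=> True) T T'.
Proof.
have step i a (S : {ffun I -> J}) : edge (fun=> True) S (upd S i a).
  have [k ki] : exists k : I, k != i by apply: card_gt1_neq; exact: leq_trans cardI.
  exists i, (fun j => (j == k)%:R); split=> //.
  - split=> [j|]; first exact: ler0n.
    by rewrite (bigD1 k)//= eqxx big1 ?addr0// => j /negPf ->.
  - by rewrite eq_sym (negPf ki).
  - by move=> j /negPf ji; rewrite ffunE ji.
have [m] := ubnP #|[pred i | T i != T' i]|; elim: m => // m IHm in T *.
rewrite ltnS => Tm; have [TT'|] := eqVneq T T'; first by rewrite TT'; exact: rt_refl.
move=> /eqP TT'; have [i Ti] : exists i, T i != T' i.
  apply: contrapT => h; apply: TT'; apply/ffunP => i; apply/eqP.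
  by apply: contrapT => /negP Ti; apply: h; exists i.
apply: (rt_trans _ _ _ (upd T i (T' i))); first exact/rt_step/step.
apply: IHm; rewrite (leq_trans _ Tm)//; apply/proper_card/properP; split.
  apply/fintype.subsetP => k; rewrite !inE ffunE.
  by case: (k =P i) => // ->; rewrite eqxx.
by exists i; rewrite !inE// ffunE !eqxx.
Qed.

(** Weights avoiding [i] form a compact set, the slice of a box by the hyperplane of sum 1, and
    [sqn] is continuous. *)
Lemma minimal_weights T i : (1 < #|I|)%N -> exists l, [/\ weights l, l i = 0 &
  forall l', weights l' -> l' i = 0 -> sqn T l <= sqn T l'].
Proof.
move=> I1.
pose f (v : 'rV[R]_#|I|) := sqn T (fun k => v 0 (enum_rank k)).
pose box (j : 'I_#|I|) : set R :=
  if j == enum_rank i then [set 0]%classic else `[0, 1]%classic.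
pose A := ([set v : 'rV[R]_#|I| | forall j, box j (v ord0 j)] `&`
  [set v : 'rV[R]_#|I| | \sum_j v ord0 j = 1])%classic.
have sumE (v : 'rV[R]_#|I|) : \sum_k v 0 (enum_rank k) = \sum_j v 0 j.
  rewrite [RHS](reindex (@enum_rank I)) /=; last exact/onW_bij/enum_rank_bij.
  exact: eq_bigr.
have AP v : A v <-> weights (fun k => v 0 (enum_rank k)) /\ v 0 (enum_rank i) = 0.
  rewrite /weights sumE; split.
    move=> [vbox v1]; have vi : v 0 (enum_rank i) = 0.
      by have := vbox (enum_rank i); rewrite /box eqxx.
    split=> //; split=> // k; have := vbox (enum_rank k); rewrite /box.
    by case: ifP => [_ /= ->//|_ /=]; rewrite in_itv /= => /andP[].
  move=> [[v0 v1] vi]; split=> // j; rewrite /box.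
  case: eqP => [->//|_] /=; rewrite in_itv /=.
  have vj : 0 <= v 0 j by rewrite -(enum_valK j).
  rewrite vj -v1 (bigD1 j)//= lerDl; apply: sumr_ge0 => k _.
  by rewrite -(enum_valK k).
have sum_cont (K : finType) (g : K -> 'rV[R]_#|I| -> R) :
    (forall k, continuous (g k)) -> continuous (fun v => \sum_k g k v).
  by move=> gc; apply: continuous_big => //; exact: add_continuous.
have fcont : continuous f.
  have bcont k : continuous (fun v : 'rV[R]_#|I| =>
      bary T (fun k => v 0 (enum_rank k)) 0 k).
    rewrite (_ : (fun v => _) = (fun v : 'rV[R]_#|I| =>
      \sum_j v 0 (enum_rank j) * V j (T j) 0 k)); last first.
      by apply/funext => v; rewrite summxE; apply: eq_bigr => j _; rewrite mxE.
    apply: sum_cont => j v; apply: continuousM; last exact: cst_continuous.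
    exact: coord_continuous.
  by apply: sum_cont => k v; apply: continuousM; exact: bcont.
have Acomp : compact A.
  apply: compact_closedI.
    apply: rV_compact => j; rewrite /box; case: ifP => _.
      exact: compact_set1.
    exact: segment_compact.
  apply: (preimage_closed (fun v => _) (@closed_eq R 1)) => v _.
  by apply: sum_cont => k; exact: coord_continuous.
have A0 : (A !=set0)%classic.
  have [k ki] := card_gt1_neq i I1.
  exists (\row_j (enum_val j == k)%:R); apply/AP.
  rewrite mxE enum_rankK eq_sym (negPf ki); split=> //; split=> [j|].
    by rewrite mxE ler0n.
  under eq_bigr do rewrite mxE enum_rankK.
  by rewrite (bigD1 k)//= eqxx big1 ?addr0// => j /negPf ->.
have [v vA vmin] := EVT_min_rV A0 Acomp (continuous_subspaceT fcont).
move: vA; rewrite inE => /AP[vw vi].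
exists (fun k => v 0 (enum_rank k)); split=> // l lw li.
have lE : l = (fun k => (\row_j l (enum_val j)) 0 (enum_rank k)) :> (I -> R).
  by apply/funext => k; rewrite mxE enum_rankK.
rewrite lE; apply: vmin; rewrite inE; apply/AP.
by rewrite -lE mxE enum_rankK.
Qed.

(** Induction on the number of heights strictly between 0 and the level: the largest becomes the
    next level for [path_descent]. The ends have 0 in their hull, so they are not high at any
    positive level. *)
Lemma zero_connected T T' : (exists l, weights l /\ bary T l = 0) ->
  (exists l, weights l /\ bary T' l = 0) -> path (fun x => x <= 0) T T'.
Proof.
move=> [l [lw lT]] [l' [lw' lT']].
have card1 : (1 < #|I|)%N by rewrite (leq_trans _ cardI).
have hgt (p : {ffun I -> J} * I) : exists c, (exists l, [/\ weights l, l p.2 = 0 &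
    sqn p.1 l = c]) /\ forall l, weights l -> l p.2 = 0 -> c <= sqn p.1 l.
  have [m [mw mp mmin]] := minimal_weights p.1 p.2 card1.
  by exists (sqn p.1 m); split=> //; exists m.
have [h hP] := fin_all_exists hgt => {hgt}.
have hge p : 0 <= h p by have [[m [_ _ <-]] _] := hP p; exact: dot_ge0.
have edgeE C S S' : (forall x y, x <= y -> C y -> C x) -> edge C S S' ->
    exists i, (forall k, k != i -> S k = S' k) /\ C (h (S, i)).
  move=> Cdown [i [m [mw mi SS' Cm]]]; exists i; split=> //.
  by apply: Cdown Cm; apply (hP (S, i)).2.
have Eedge (C : R -> Prop) (S S' : {ffun I -> J}) i :
    (forall k, k != i -> S k = S' k) -> C (h (S, i)) -> edge C S S'.
  by move=> SS' Ch; have [[m [mw mi mE]] _] := hP (S, i); exists i, m; rewrite mE.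
have lo c S m : 0 < c -> weights m -> bary S m = 0 -> ~ high c S.
  by move=> c0 mw mS /(_ m mw); rewrite /sqn mS dot0l leNgt c0.
(* Exceeds every height, so this level excludes no edge. *)
pose c0 := 1 + \sum_p h p.
suff main c : path (fun x => x < c) T T' -> path (fun x => x <= 0) T T'.
  apply: (main c0); apply: (crt_mono _ (swap_connected T T')).
  move=> S S' /edgeE[//|i [SS' _]]; apply: Eedge SS' _.
  rewrite /c0 (bigD1 (S, i))//= addrCA ltrDl ltr_wpDr//.
  exact: sumr_ge0.
have [m] := ubnP #|[pred p | 0 < h p < c]|; elim: m => // m IHm in c *.
rewrite ltnS => cm cTT'.
have [[p0 p0P]|none] := pselect (exists p, 0 < h p < c); last first.
  apply: crt_mono cTT' => S S' /edgeE[x y /le_lt_trans xy /xy //|i [SS' hc]].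
  apply: Eedge SS' _; rewrite leNgt; apply/negP => h0; apply: none.
  by exists (S, i); rewrite h0.
case: (@arg_maxP _ R _ p0 (fun p => 0 < h p < c) h p0P) => q /andP[q0 qc] qmax.
apply: (IHm (h q)).
  rewrite (leq_trans _ cm)//; apply/proper_card/properP; split.
    by apply/fintype.subsetP => p; rewrite !inE => /andP[-> /lt_trans->].
  by exists q; rewrite !inE ?q0 ?qc// ltxx andbF.
apply: path_descent => //; [exact: (lo _ _ l)|exact: (lo _ _ l')|].
apply: crt_mono cTT' => S S' /edgeE[x y /le_lt_trans xy /xy //|i [SS' hc]].
apply: Eedge SS' _; have [h0|h0] := ltP 0 (h (S, i)).
  by apply: qmax; rewrite h0.
exact: le_trans h0 (ltW q0).
Qed.

End Descent.

End Colourful.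

(** * Sarkaria's transformation and Tverberg partitions *)

Section Sarkaria.
Local Open Scope fset_scope.
Variables (R : realType) (d r : nat) (X : {fset 'rV[R]_d}).
Implicit Types (T : {ffun X -> 'I_r.+1}) (l : X -> R).

(* The r+1 vectors [scoef j] sum to 0 and any r of them are independent, so
   a combination of them vanishes iff all its coefficients are equal. *)
Definition scoef (j : 'I_r.+1) (k : 'I_r) : R :=
  (j == lift ord0 k)%:R - (j == ord0)%:R.

(** The leading 1 makes class sums record mass as well as position. *)
Definition lift1 (x : 'rV[R]_d) : 'rV[R]_(1 + d) := row_mx 1 x.

Definition sarkaria (i : X) (j : 'I_r.+1) : 'rV[R]_(r * (1 + d)) :=
  mxvec (\matrix_(k, m) (scoef j k * lift1 (val i) 0 m)).

(** The vectors of one point sum to 0, so their inner products with [z] cannot all be positive. *)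
Lemma sarkaria_balanced i z : exists j, dot (sarkaria i j) z <= 0.
Proof.
apply: contrapT => h.
have pos j : 0 < dot (sarkaria i j) z.
  by rewrite ltNge; apply/negP => ?; apply: h; exists j.
have : \sum_j dot (sarkaria i j) z = 0.
  rewrite -dot_suml (_ : \sum_j _ = 0) ?dot0l//; apply/rowP => q.
  rewrite mxE summxE; case/mxvec_indexP: q => k m.
  under eq_bigr do rewrite mxvecE mxE.
  have delta (a : 'I_r.+1) : \sum_j (j == a)%:R = 1 :> R.
    by rewrite (bigD1 a)//= eqxx big1 ?addr0// => j /negPf ->.
  by rewrite -mulr_suml /scoef sumrB !delta subrr mul0r.
move=> /eqP; rewrite psumr_eq0 => [/allP/(_ ord0 (mem_index_enum _))/=|j _].
  by rewrite gt_eqF.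
exact: ltW.
Qed.

Definition class_sum T l j : 'rV[R]_(1 + d) :=
  \sum_(i | T i == j) l i *: lift1 (val i).

(** Block [k] of the barycentre is the class sum of [lift ord0 k] minus that of [ord0]. *)
Lemma bary_sarkaria T l :
  bary sarkaria T l = 0 <-> forall j, class_sum T l j = class_sum T l ord0.
Proof.
have E k m : bary sarkaria T l 0 (mxvec_index k m) =
    class_sum T l (lift ord0 k) 0 m - class_sum T l ord0 0 m.
  rewrite /bary /class_sum !summxE (big_mkcond (fun i => T i == lift _ _)).
  rewrite (big_mkcond (fun i => T i == ord0)) -sumrB; apply: eq_bigr => i _.
  rewrite mxE mxvecE mxE /scoef.
  have sc : (l i *: lift1 (val i)) 0 m = l i * lift1 (val i) 0 m by rewrite mxE.
  have z0 : (0 : 'rV[R]_(1 + d)) 0 m = 0 by rewrite mxE.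
  case: ifP => _; case: ifP => _; rewrite ?(mulr1n, mulr0n) ?sc ?z0; ring.
split=> [b0 j|h].
  have [->//|[k ->]] : j = ord0 \/ exists k, j = lift ord0 k.
    by case: (unliftP ord0 j) => [k|] ->; [right; exists k|left].
  by apply/rowP => m; apply/eqP; rewrite -subr_eq0 -E b0 mxE.
by apply/rowP => q; case/mxvec_indexP: q => k m; rewrite E h subrr mxE.
Qed.

Lemma class_sumE T l j : class_sum T l j =
  row_mx (\sum_(i | T i == j) l i)%:M (\sum_(i | T i == j) l i *: val i).
Proof.
rewrite /class_sum; elim/big_rec3: _ => [|i x y z _ ->].
  by rewrite (raddf0 (@scalar_mx R 1)) row_mx0.
by rewrite /lift1 scale_row_mx add_row_mx raddfD /= -(scalemx1 _ (l i)).
Qed.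

Definition part T : {ffun 'I_r.+1 -> {fset 'rV[R]_d}} :=
  [ffun j => [fset x in X | oapp (fun i => T i == j) false (insub x)]].

Lemma mem_part T j x : x \in part T j ->
  exists i : X, val i = x /\ T i = j.
Proof.
rewrite ffunE !inE => /andP[_]; case: insubP => //= i _ <- /eqP <-.
by exists i.
Qed.

Lemma val_part T j (i : X) : (val i \in part T j) = (T i == j).
Proof. by rewrite ffunE !inE valK /= fsvalP. Qed.

Lemma part_sub T j : part T j `<=` X.
Proof. by apply/fsubsetP => x /mem_part[i [<- _]]; exact: valP. Qed.

Lemma big_part (W : nmodType) T j (F : 'rV[R]_d -> W) :
  \sum_(x <- part T j) F x = \sum_(i : X | T i == j) F (val i).
Proof.
rewrite ffunE big_fset/= big_seq_fsetE /=.
by apply: eq_bigl => i; rewrite valK.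
Qed.

Lemma part_partition T : is_ordered_partition X (part T).
Proof.
split=> [i j ij|x].
  apply/fsetP => x; rewrite !inE; apply/negP => /andP[/mem_part[k [<- ki]]].
  by rewrite val_part ki (negPf ij).
split=> [xX|[j /(fsubsetP (part_sub T j))//]].
by exists (T (FSetSub xX)); have := val_part T (T (FSetSub xX)) (FSetSub xX); rewrite eqxx.
Qed.

Lemma partition_del (Y : {fset 'rV[R]_d}) x (P : {ffun 'I_r.+1 -> {fset 'rV[R]_d}}) :
  is_ordered_partition Y P -> is_ordered_partition (Y `\ x) (del_pt x P).
Proof.
move=> [dis cov]; split=> [i j ij|y].
  rewrite !ffunE; apply/fsetP => y; rewrite !inE.
  have /fsetP/(_ y) := dis i j ij; rewrite !inE.
  by case: (y == x) => //=; rewrite andbF.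
rewrite !inE; split=> [/andP[yx /cov[j yj]]|[j]].
  by exists j; rewrite ffunE !inE yx.
by rewrite ffunE !inE => /andP[-> yj]; apply/cov; exists j.
Qed.

Lemma partition_part P : is_ordered_partition X P -> exists T, P = part T.
Proof.
move=> [dis cov].
have /fin_all_exists[t tP] : forall i : X, exists j, val i \in P j.
  by move=> i; apply/cov/valP.
exists (finfun t); apply/ffunP => j; apply/fsetP => x.
apply/idP/idP => [xj|/mem_part[i [<- <-]]]; last by rewrite ffunE.
have xX : x \in X by apply/cov; exists j.
rewrite -[x]/(val (FSetSub xX)) val_part ffunE.
apply: contrapT => /negP /dis/fsetP/(_ x).
by rewrite in_fset0 in_fsetI xj andbT => /negP; apply; exact: tP (FSetSub xX).
Qed.

(** All classes have mass [1 / (r + 1)] and the same weighted sum; rescaling gives the common point.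
    Letting [S] miss points of weight zero also covers deletions. *)
Lemma bary0_in_conv T l : weights l -> bary sarkaria T l = 0 ->
  exists p, forall j (S : {fset 'rV[R]_d}), S `<=` part T j ->
    (forall i : X, T i = j -> val i \notin S -> l i = 0) -> in_conv S p.
Proof.
move=> [l0 l1] /bary_sarkaria h.
pose mass j := \sum_(i | T i == j) l i.
pose q j := \sum_(i | T i == j) l i *: val i.
have [massE qE] : (forall j, mass j = mass ord0) /\ (forall j, q j = q ord0).
  have mq j : mass j = mass ord0 /\ q j = q ord0.
    have := h j; rewrite !class_sumE => /eq_row_mx[/matrixP/(_ 0 0)].
    by rewrite !mxE !mulr1n.
  by split=> j; have [] := mq j.
have rmass : r.+1%:R * mass ord0 = 1.
  rewrite -[RHS]l1 (partition_big T xpredT)//= (eq_bigr _ (fun j _ => massE j)).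
  by rewrite sumr_const card_ord mulr_natl.
pose w (x : 'rV[R]_d) := oapp (fun i : X => r.+1%:R * l i) 0 (insub x).
have wE (i : X) : w (val i) = r.+1%:R * l i by rewrite /w valK.
exists (r.+1%:R *: q ord0) => j S sub S0.
have outside x : x \in part T j -> x \notin S -> w x = 0.
  by move=> /mem_part[i [<- ij]] iS; rewrite wE S0// mulr0.
exists w; split.
- move=> x; rewrite /w; case: insub => //= i _.
  by rewrite mulr_ge0// ler0n.
- rewrite (big_fset_incl _ sub outside) big_part.
  by under eq_bigr do rewrite wE; rewrite -mulr_sumr -/(mass j) massE.
- rewrite (big_fset_incl _ sub); last by move=> x xj /outside -> //; rewrite scale0r.
  rewrite big_part; under eq_bigr do rewrite wE -scalerA.
  by rewrite -scaler_sumr -/(q j) qE.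
Qed.

Lemma tverberg_part T l : weights l -> bary sarkaria T l = 0 -> is_tverberg X (part T).
Proof.
move=> lw lT; split; first exact: part_partition.
have [p pP] := bary0_in_conv lw lT; exists p => j; apply: (pP j) => // i ij.
by rewrite val_part ij eqxx.
Qed.

Lemma tverberg_del_part T l (x : X) : weights l -> bary sarkaria T l = 0 ->
  l x = 0 -> is_tverberg (X `\ val x) (del_pt (val x) (part T)).
Proof.
move=> lw lT lx; split; first exact/partition_del/part_partition.
have [p pP] := bary0_in_conv lw lT; exists p => j.
apply: (pP j); rewrite ffunE ?fsubsetDl// => i ij; rewrite !inE val_part ij eqxx.
by rewrite andbT negbK => /eqP/val_inj ->.
Qed.

(** Convex weights in each class, divided by [r + 1], have total 1 and equal class sums. *)
Lemma part_tverberg T : is_tverberg X (part T) ->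
  exists l, weights l /\ bary sarkaria T l = 0.
Proof.
move=> [_ [p /fin_all_exists[w wP]]].
have r0 : r.+1%:R != 0 :> R by rewrite pnatr_eq0.
pose l (i : X) := w (T i) (val i) / r.+1%:R.
have lsum (W : lmodType R) j (F : X -> W) :
    \sum_(i | T i == j) l i *: F i =
    r.+1%:R^-1 *: \sum_(i | T i == j) w j (val i) *: F i.
  rewrite scaler_sumr; apply: eq_bigr => i /eqP ij.
  by rewrite scalerA /l ij mulrC.
have mass j : \sum_(i | T i == j) l i = r.+1%:R^-1.
  have [_ w1 _] := wP j; rewrite big_part in w1.
  under eq_bigr => i /eqP ij do rewrite /l ij.
  by rewrite -mulr_suml w1 mul1r.
exists l; split; first split.
- move=> i; rewrite divr_ge0 ?ler0n//; have [w0 _ _] := wP (T i).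
  by apply: w0; rewrite val_part.
- rewrite (partition_big T xpredT)//= (eq_bigr _ (fun j _ => mass j)).
  by rewrite sumr_const card_ord -[LHS]mulr_natl divff.
apply/bary_sarkaria => j; rewrite !class_sumE !mass !lsum.
have cp k : \sum_(i | T i == k) w k (val i) *: val i = p.
  by have [_ _] := wP k; rewrite big_part.
by rewrite !cp.
Qed.

(** At height 0 the weights represent 0 without point [i], so deleting it keeps the partition
    Tverberg. An edge may be a loop, which becomes the empty path. *)
Lemma edge_rg T T' : edge sarkaria (fun x => x <= 0) T T' ->
  clos_refl_trans _ (rg_adj X) (part T) (part T').
Proof.
move=> [i [l [lw li TT' /dot_eq0 lT]]].
have lT' : bary sarkaria T' l = 0.
  by rewrite -lT; apply: bary_eq => k lk; rewrite TT'//;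
     apply: contraNN lk => /eqP ->; rewrite li.
have [->|neq] := eqVneq (part T) (part T'); first exact: rt_refl.
apply: rt_step; split; first exact: tverberg_part lw lT.
split; first exact: tverberg_part lw lT'.
split=> //; exists (val i); split.
- exact: valP.
- move=> j; apply/fsetP => x; rewrite !in_fsetD1.
  have [//|xi] /= := eqVneq x (val i).
  apply/idP/idP => /mem_part[k [kx <-]]; move: xi; rewrite -kx val_part => ki.
    by rewrite TT'//; apply: contraNN ki => /eqP ->.
  by rewrite TT'//; apply: contraNN ki => /eqP ->.
- exact: tverberg_del_part lw lT li.
- exact: tverberg_del_part lw lT' li.
Qed.

End Sarkaria.

Local Open Scope fset_scope.

Theorem theorem1p2 (R : realType) (d r : nat) (X : {fset 'rV[R]_d}) :
  (1 <= r)%N ->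
  ((d.+1 * (r - 1) + 2) <= #|` X|)%N ->
  rg_connected r X.
Proof.
case: r => // r _; rewrite subSS subn0 => cardX P Q tP tQ.
have [T PT] := partition_part tP.1; have [T' QT'] := partition_part tQ.1.
subst P Q.
(* With [r.+1] classes the vectors have dimension [n = r * (1 + d)], and the bound on [X] is
   [n + 2]. *)
have cardI : ((r * (1 + d)).+2 <= #|{: X}|)%N.
  by rewrite -cardfE add1n mulnC -addn2.
have := zero_connected cardI (@sarkaria_balanced R d r X)
  (part_tverberg tP) (part_tverberg tQ).
elim=> {T T' tP tQ} [T T' /edge_rg//|T|T1 T2 T3 _ h12 _ h23].
  exact: rt_refl.
exact: rt_trans h23.
Qed.
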